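(* Let $k\ge 1$. For every $\zeta\in\ker\partial_k$ (viewed as a cochain, i.e. as a linear function on $\mathcal C_k$) and for any $\sigma\in\mathcal C_k$, $$\mathcal A\zeta(\sigma)=-L_k^{\uparrow}\zeta(\sigma)=-L_k\zeta(\sigma).$$
   Context: Let $\mathbf C$ be a simplicial complex on a finite or countable totally ordered vertex set $V$. Oriented $k$-simplexes are written $[v_0,\dots,v_k]$ and change sign when two vertices are exchanged. $\mathcal S_k$ is the set of all oriented $k$-simplexes (both orientations), and $\mathcal S_k^+$ is the subset of those with $v_0<\dots<v_k$. $\mathcal C_k$ is the real space of $k$-chains $\sigma=\sum_{\tau\in\mathcal S_k^+}\lambda_\tau(\sigma)\tau$, with the inner product for which $\mathcal S_k^+$ is an orthonormal basis. $\mathcal C^k$ is its dual, identified with $\mathcal C_k$ through this inner product ($\eta^*$ denotes the cochain associated with a chain $\eta$), and $\langle f,\sigma\rangle_{\mathcal C^k,\mathcal C_k}=f(\sigma)$. The boundary map $\partial_k:\mathcal C_k\to\mathcal C_{k-1}$ is linear with $\partial_k[v_0,\dots,v_k]=\sum_{i=0}^k(-1)^i[v_0,\dots,v_{i-1},v_{i+1},\dots,v_k]$, and $\partial_0=0$. Its adjoint $\partial_k^*:\mathcal C^{k-1}\to\mathcal C^k$ is $(\partial_k^*f)(\sigma)=f(\partial_k\sigma)$; the adjoints are supposed well defined on these (identified) spaces, which is automatic for a finite complex. The upper, lower and combinatorial Laplacians are $L_k^\uparrow=\partial_{k+1}\partial_{k+1}^*$, $L_k^\downarrow=\partial_k^*\partial_k$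 and $L_k=L_k^\uparrow+L_k^\downarrow$. For $\sigma\in\mathcal C_k$ and $\tau\in\mathcal S_{k+1}$ put $w(\sigma,\partial_{k+1}\tau)=\max(\langle(\partial_{k+1}\tau)^*,\sigma\rangle_{\mathcal C^k,\mathcal C_k},0)$. Write $\sigma\sim\sigma'$ if there is $\tau\in\mathcal S_{k+1}$ with $w(\sigma,\partial_{k+1}\tau)>0$ and $\sigma'=\sigma-\partial_{k+1}\tau$; then set $K(\sigma,\sigma')=w(\sigma,\sigma-\sigma')$. For a function $F$ on $\mathcal C_k$ for which the sum converges, $\mathcal AF(\sigma)=\sum_{\sigma'\sim\sigma}(F(\sigma')-F(\sigma))K(\sigma,\sigma')$. *)

(* Defs.v *)
From HB Require Import structures.
From mathcomp Require Export all_boot all_order all_algebra all_fingroup.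
From mathcomp Require Export finmap.
From mathcomp Require Export boolp classical_sets cardinality fsbigop reals.
From mathcomp Require Export monalg.
From mathcomp Require Import zify.

Set Implicit Arguments.
Unset Strict Implicit.
Unset Printing Implicit Defensive.

Export Order.TTheory GRing.Theory Num.Theory.

Local Open Scope fset_scope.
Local Open Scope ring_scope.

Record simplicial_complex (d : Order.disp_t) (V : orderType d) := {
  face_of :> {fset V} -> bool;
  complex_nonempty : forall s, face_of s -> s != fset0;
  complex_closed : forall s t : {fset V},
    face_of s -> t `<=` s -> t != fset0 -> face_of t }.

Section Chains.
Variables (R : realType) (d : Order.disp_t) (V : orderType d).
Variable C : simplicial_complex V.

(* The positively oriented k-simplexes, i.e. the basis S_k^+. *)
Definition is_simplex (k : nat) (t : k.+1.-tuple V) : bool :=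
  sorted <%O t && C [fset v in tval t].

Definition simplex (k : nat) : choiceType :=
  {t : k.+1.-tuple V | is_simplex t}.

(* Finite formal linear combinations of positively oriented k-simplexes. *)
Definition chain (k : nat) : lmodType R := {malg R[simplex k]}.

(* [v_0, ..., v_k] is the sign of s times the positively oriented simplex t
   when (v_0, ..., v_k) is t permuted by s; this set is S_k. *)
Definition oriented_simplex (k : nat) : set (chain k) :=
  [set x | exists (s : 'S_k.+1) (t : simplex k), x = (-1) ^+ s *: << t >>]%classic.

Definition drop_vertex (k : nat) (i : 'I_k.+2) (t : k.+2.-tuple V) :
  k.+1.-tuple V := [tuple tnth t (lift i j) | j < k.+1].

Lemma drop_vertex_simplex (k : nat) (i : 'I_k.+2) (t : k.+2.-tuple V) :
  is_simplex t -> is_simplex (drop_vertex i t).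
Proof.
move=> /andP[st Ct]; apply/andP; split.
  have ltt (a b : 'I_k.+2) : (a < b)%N -> (tnth t a < tnth t b)%O.
    move=> ab; have := tnth t ord0 => x0; rewrite !(tnth_nth x0).
    by apply: (sorted_ltn_nth lt_trans) => //; rewrite inE size_tuple.
  have := tnth t ord0 => x0; apply/(sortedP x0) => j.
  rewrite size_tuple => jk; have jk' := ltnW jk.
  have -> : nth x0 (drop_vertex i t) j = tnth t (lift i (Ordinal jk')).
    by rewrite -[j in LHS]/(nat_of_ord (Ordinal jk')) -tnth_nth tnth_mktuple.
  have -> : nth x0 (drop_vertex i t) j.+1 = tnth t (lift i (Ordinal jk)).
    by rewrite -[j.+1]/(nat_of_ord (Ordinal jk)) -tnth_nth tnth_mktuple.
  by apply: ltt; rewrite /= /bump; lia.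
apply: (complex_closed Ct).
  apply/fsubsetP => v; rewrite !inE => /tnthP[j ->].
  by rewrite tnth_mktuple mem_tnth.
by apply/fset0Pn; exists (tnth (drop_vertex i t) ord0); rewrite !inE mem_tnth.
Qed.

Definition face (k : nat) (i : 'I_k.+2) (t : simplex k.+1) : simplex k :=
  exist _ (drop_vertex i (val t)) (drop_vertex_simplex i (valP t)).

(* boundary k goes from C_k to C_(k-1); since 0.-1 = 0, the zero map d_0 is
   given the (immaterial) codomain C_0. *)
Definition boundary (k : nat) : chain k -> chain k.-1 :=
  match k return chain k -> chain k.-1 with
  | 0 => fun _ => 0
  | j.+1 => fun x =>
      \sum_(t <- msupp x) x@_t *: \sum_(i < j.+2) (-1) ^+ i *: << face i t >>
  end.

(* The inner product for which S_k^+ is orthonormal; [dual x] is the cochain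
   x^* associated with the chain x. *)
Definition dual (k : nat) (x y : chain k) : R :=
  \sum_(t <- msupp x) x@_t * y@_t.

(* C^k is identified with C_k, so that an adjoint of the boundary map acts on
   chains; for finitely supported chains its existence is local finiteness. *)
Definition is_adjoint (k : nat) (D : chain k.-1 -> chain k) : Prop :=
  forall (f : chain k.-1) (x : chain k), dual (D f) x = dual f (boundary x).

Section Laplacians.
(* The family of adjoints of the boundary maps. *)
Variable bdadj : forall k : nat, chain k.-1 -> chain k.

Definition up_laplacian (k : nat) (x : chain k) : chain k :=
  @boundary k.+1 (@bdadj k.+1 x).

Definition down_laplacian (k : nat) (x : chain k) : chain k :=
  @bdadj k (boundary x).

Definition laplacian (k : nat) (x : chain k) : chain k :=
  up_laplacian x + down_laplacian x.

End Laplacians.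

Definition weight (k : nat) (x b : chain k) : R := Num.max (dual b x) 0.

Definition neighbor (k : nat) (x y : chain k) : Prop :=
  exists t : chain k.+1, [/\ @oriented_simplex k.+1 t,
    0 < weight x (boundary t : chain k) & y = x - boundary t].

Definition kernel (k : nat) (x y : chain k) : R := weight x (x - y).

(* The sum runs over the neighbors y of x, each counted once. It is a finite
   sum as soon as the boundary maps have adjoints: every simplex then has
   finitely many cofaces. *)
Definition generator (k : nat) (F : chain k -> R) (x : chain k) : R :=
  \sum_(y \in [set y : chain k | neighbor x y]%classic)
    (F y - F x) * kernel x y.

End Chains.

(* Main.v *)
(* For [t] a positively oriented (k+1)-simplex, the adjoint property identifies
   the flow of [x] across the boundary of [t] with the coefficient at [t] of
   the coboundary [D x]. Hence the neighbors of [x] are the chains [x - s d(t)],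
   with [t] in the support of [D x] and [s] the sign of that coefficient; they
   are pairwise distinct because a simplex is determined by its faces. The
   generator then reduces to minus the inner product of [D zeta] and [D x], and
   moving [D] back across the adjunction gives the upper Laplacian. *)
From mathcomp Require Import functions.
Require Import Defs.

Set Implicit Arguments.
Unset Strict Implicit.
Unset Printing Implicit Defensive.

Local Open Scope fset_scope.
Local Open Scope ring_scope.

Section Chains.
Variables (R : realType) (d : Order.disp_t) (V : orderType d).
Variable C : simplicial_complex V.

Section InnerProduct.
Variable k : nat.
Implicit Types x y z : chain R C k.

(** Summing over any superset of the support lets both orders of the pairing run over one common
    set, which gives symmetry. *)
Lemma dualEw (E : {fset simplex C k}) x y :
  msupp x `<=` E -> dual x y = \sum_(t <- E) x@_t * y@_t.
Proof.
move=> xE; rewrite /dual (big_fset_incl _ xE) // => t _ tx.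
by rewrite (mcoeff_outdom tx) mul0r.
Qed.

Lemma dualC x y : dual x y = dual y x.
Proof.
rewrite (dualEw _ (fsubsetUl (msupp x) (msupp y))).
rewrite (dualEw _ (fsubsetUr (msupp x) (msupp y))).
by apply: eq_bigr => t _; rewrite mulrC.
Qed.

Lemma dualDr x y z : dual x (y + z) = dual x y + dual x z.
Proof.
by rewrite /dual -big_split; apply: eq_bigr => t _; rewrite mcoeffD mulrDr.
Qed.

Lemma dualDl x y z : dual (x + y) z = dual x z + dual y z.
Proof. by rewrite !(dualC _ z) dualDr. Qed.

Lemma dualZr a x y : dual x (a *: y) = a * dual x y.
Proof.
by rewrite /dual mulr_sumr; apply: eq_bigr => t _; rewrite mcoeffZ mulrCA.
Qed.

Lemma dual0r x : dual x 0 = 0.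
Proof. by rewrite /dual big1 // => t _; rewrite mcoeff0 mulr0. Qed.

Lemma dualUr x (t : simplex C k) : dual x << t >> = x@_t.
Proof. by rewrite dualC /dual msuppU oner_eq0 big_seq_fset1 mcoeffUU mul1r. Qed.

End InnerProduct.

Section Boundary.
Variable k : nat.
Implicit Types t u : simplex C k.+1.

Lemma boundaryU t :
  boundary (<< t >> : chain R C k.+1) =
  \sum_(i < k.+2) (-1) ^+ i *: << face i t >>.
Proof. by rewrite /boundary msuppU oner_eq0 big_seq_fset1 mcoeffUU scale1r. Qed.

Lemma boundaryZU (a : R) t :
  boundary (a *: << t >> : chain R C k.+1) =
  a *: boundary (<< t >> : chain R C k.+1).
Proof.
rewrite boundaryU /boundary msuppZ; have [->|a0] := eqVneq a 0.
  by rewrite big_seq_fset0 scale0r.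
by rewrite msuppU oner_eq0 big_seq_fset1 mcoeffZ mcoeffUU mulr1.
Qed.

Lemma mem_face (i : 'I_k.+2) t v :
  (v \in val (face i t)) = [exists j, v == tnth (val t) (lift i j)].
Proof.
apply/tnthP/existsP => -[j]; first by rewrite tnth_mktuple => ->; exists j.
by move/eqP->; exists j; rewrite tnth_mktuple.
Qed.

Lemma mem_face_tnth (i j : 'I_k.+2) t :
  j != i -> tnth (val t) i \in val (face j t).
Proof.
rewrite mem_face; case: (unliftP j i) => [l -> _|->]; last by rewrite eqxx.
by apply/existsP; exists l.
Qed.

Lemma simplex_uniq t : uniq (val t).
Proof. by case/andP: (valP t) => /lt_sorted_uniq. Qed.

(** Both vertex lists are duplicate-free of the same length, so inclusion makes them equal as sets,
    and a strictly sorted list is determined by its set of entries. *)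
Lemma simplex_subset_eq t u : {subset val t <= val u} -> t = u.
Proof.
move=> tu; apply/val_inj/val_inj.
have tu_size : (size (val u) <= size (val t))%N by rewrite !size_tuple.
have [_ tu_mem] := uniq_min_size (simplex_uniq t) tu tu_size.
by case/andP: (valP t) (valP u) => st _ /andP[su _]; apply: lt_sorted_eq tu_mem.
Qed.

(** Vertex [i] of [t] is missing from its [i]-th face but belongs to all the others. Hence no two
    terms of the boundary can cancel. *)
Lemma face_inj t : injective (fun i : 'I_k.+2 => face i t).
Proof.
move=> i j fij; apply/eqP; rewrite eq_sym; apply/negP => /negP ji.
have := mem_face_tnth t ji; rewrite -fij mem_face.
move=> /existsP[l /eqP/(tuple_uniqP _ (simplex_uniq t)) il].
by have := neq_lift i l; rewrite -il eqxx.
Qed.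

Lemma mcoeff_boundaryU t (s : simplex C k) :
  (boundary (<< t >> : chain R C k.+1))@_s =
  \sum_(i < k.+2) (-1) ^+ i * (face i t == s)%:R.
Proof.
rewrite boundaryU (big_morph (mcoeff s) (mcoeffD s) (mcoeff0 s)).
by apply: eq_bigr => i _; rewrite mcoeffZ mcoeffU.
Qed.

Lemma mcoeff_boundary_face t (i : 'I_k.+2) :
  (boundary (<< t >> : chain R C k.+1))@_(face i t) = (-1) ^+ i.
Proof.
rewrite mcoeff_boundaryU (bigD1 i) //= eqxx mulr1 big1 ?addr0 // => j ji.
by rewrite (inj_eq (@face_inj t)) (negPf ji) mulr0.
Qed.

Lemma mcoeff_boundary_neq0 t (s : simplex C k) :
  (boundary (<< t >> : chain R C k.+1))@_s != 0 -> exists i, s = face i t.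
Proof.
move=> /eqP; rewrite mcoeff_boundaryU.
case: (pickP (fun i => face i t == s)) => [i /eqP <-|tN]; first by exists i.
by case; apply: big1 => i _; rewrite tN mulr0.
Qed.

(** Each vertex of [t] lies on some face of [t]; that face has a nonzero coefficient, so it is also
    a face of [u], and the vertex belongs to [u]. *)
Lemma boundary_inj t u (a b : R) : a != 0 ->
  a *: boundary (<< t >> : chain R C k.+1) =
  b *: boundary (<< u >> : chain R C k.+1) ->
  t = u.
Proof.
move=> a0 tu; apply: simplex_subset_eq => v /tnthP[i ->].
have [j ij] : exists j : 'I_k.+2, j != i.
  by exists (lift i ord0); rewrite eq_sym neq_lift.
have : (a *: boundary (<< t >> : chain R C k.+1))@_(face j t) != 0.
  by rewrite mcoeffZ (mcoeff_boundary_face t j) mulf_eq0 negb_or a0 signr_eq0.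
rewrite tu mcoeffZ mulf_eq0 negb_or => /andP[_ /mcoeff_boundary_neq0[l fl]].
have := mem_face_tnth t ij.
by rewrite fl mem_face => /existsP[m /eqP ->]; apply: mem_tnth.
Qed.

Lemma oriented_simplexP (x : chain R C k.+1) :
  oriented_simplex x <-> exists (b : bool) t, x = (-1) ^+ b *: << t >>.
Proof.
split=> [[s [t ->]]|[b [t ->]]]; first by exists s, t.
(* There are at least two vertices, so exchanging the first and the last is an odd permutation. *)
exists (if b then tperm ord0 ord_max else 1%g), t.
by case: b; rewrite ?odd_perm1 ?odd_tperm.
Qed.

End Boundary.

Section Generator.
Variables (k : nat) (D : chain R C k -> chain R C k.+1).
Hypothesis DP : @is_adjoint R d V C k.+1 D.

Lemma dual_boundaryU (x : chain R C k) (t : simplex C k.+1) :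
  dual x (boundary (<< t >> : chain R C k.+1)) = (D x)@_t.
Proof. by rewrite -[LHS]DP dualUr. Qed.

(** The sign selects the orientation of [t] across which the flow of [x] is positive. *)
Definition step (x : chain R C k) (t : simplex C k.+1) : chain R C k :=
  x - Num.sg (D x)@_t *: boundary (<< t >> : chain R C k.+1).

Lemma step_inj (x : chain R C k) : set_inj [set` msupp (D x)]%classic (step x).
Proof.
move=> t u; rewrite inE /= -mcoeff_neq0 -sgr_eq0 => t0 _ /addrI/oppr_inj.
exact: boundary_inj.
Qed.

(** Across [t] with sign [(-1) ^+ b] the flow is [(-1) ^+ b * (D x)@_t], which is positive exactly
    when [(-1) ^+ b] is the sign of that coefficient. *)
Lemma neighbor_step (x : chain R C k) :
  [set y | neighbor x y]%classic = (step x @` [set` msupp (D x)])%classic.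
Proof.
apply/seteqP; split=> y /=.
  move=> [_ [/oriented_simplexP[b [t ->]] w0 ->]]; move: w0.
  rewrite boundaryZU /weight lt_max ltxx orbF dualC dualZr dual_boundaryU => w0.
  have sgE : Num.sg (D x)@_t = (-1) ^+ b.
    move: w0; case: b; rewrite ?mul1r ?mulN1r ?oppr_gt0.
      exact: ltr0_sg.
    exact: gtr0_sg.
  by exists t; rewrite /step ?sgE // -mcoeff_neq0 -sgr_eq0 sgE signr_eq0.
move=> [t]; rewrite /= -mcoeff_neq0 => t0 <-.
exists ((-1) ^+ ((D x)@_t < 0)%R *: << t >>); split.
- by apply/oriented_simplexP; exists ((D x)@_t < 0)%R, t.
- rewrite boundaryZU /weight lt_max ltxx orbF dualC dualZr dual_boundaryU.
  by rewrite -normrEsign normr_gt0.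
- by rewrite boundaryZU /step neqr0_sign.
Qed.

(** Along [step x t] the increment of [dual z] is [- Num.sg (D x)@_t * (D z)@_t] and the rate is the
    absolute value of [(D x)@_t]; sign times absolute value restores the coefficient. *)
Lemma generator_dual (z x : chain R C k) :
  generator (dual z) x = - dual (boundary (D z)) x.
Proof.
rewrite /generator neighbor_step fsbig_image; last exact: step_inj.
rewrite -fsbig_seq ?fset_uniq // (dualC (boundary _)) -(DP x (D z)).
rewrite [dual (D x) _]/dual -[RHS]sumrN.
apply: eq_bigr => t _; rewrite /kernel /weight /step.
rewrite subKr -scaleNr dualDr dualZr dual_boundaryU addrAC subrr add0r.
rewrite [dual _ x]dualC dualZr dual_boundaryU -normrEsg max_l ?normr_ge0 //.
by rewrite mulrAC mulNr -numEsg mulNr.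
Qed.

End Generator.
End Chains.

Theorem theorem18 (R : realType) (d : Order.disp_t) (V : orderType d)
    (V_countable : countable [set: V]%classic)
    (C : simplicial_complex V)
    (bdadj : forall j : nat, chain R C j.-1 -> chain R C j)
    (bdadjP : forall j : nat, is_adjoint (bdadj j))
    (k : nat) (k_ge1 : (1 <= k)%N)
    (zeta : chain R C k) (zeta_ker : boundary zeta = 0)
    (sigma : chain R C k) :
  generator (dual zeta) sigma = - dual (up_laplacian bdadj zeta) sigma
  /\ - dual (up_laplacian bdadj zeta) sigma
     = - dual (laplacian bdadj zeta) sigma.
Proof.
case: k k_ge1 zeta zeta_ker sigma => // k' _ zeta zeta_ker sigma.
split; first exact: generator_dual (@bdadjP k'.+2) zeta sigma.
(* By adjunction, the lower part pairs [boundary zeta], which is zero, with [boundary sigma]. *)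
rewrite /laplacian dualDl [X in _ + X](_ : _ = 0) ?addr0 //.
by rewrite [LHS]bdadjP zeta_ker dualC dual0r.
Qed.
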